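(* Let $d\geq 2$ and $N\geq 1$. The spherical cap discrepancy $\Delta:\left(\mathbb{S}^{d-1}\right)^N\to\mathbb{R}$ is continuous.
   Context: $\mathbb{S}^{d-1}$ is the Euclidean unit sphere in $\mathbb{R}^d$ (with the metric induced by the Euclidean norm), $\sigma$ the uniform probability measure on it. For $w\in\mathbb{R}^d$, $t\in\mathbb{R}$, $H(w,t)=\{x\in\mathbb{R}^d\mid\langle w,x\rangle\geq t\}$. For $X=(x^{(1)},\ldots,x^{(N)})\in(\mathbb{S}^{d-1})^N$, $\mu^{emp}(X,w,t)=N^{-1}\#\{i\in\{1,\ldots,N\}\mid x^{(i)}\in H(w,t)\}$, and for $w\in\mathbb{S}^{d-1}$, $t\in[-1,1]$, $\mu^{cap}(t)=\sigma(\mathbb{S}^{d-1}\cap H(w,t))$ (independent of $w$). $\Delta(X)=\sup_{w\in\mathbb{S}^{d-1},t\in[-1,1]}|\mu^{emp}(X,w,t)-\mu^{cap}(t)|$. *)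

(* Defs.v *)
From HB Require Import structures.
From mathcomp Require Import all_boot all_order all_algebra.
From mathcomp Require Import all_classical all_reals all_analysis.
From mathcomp Require Import ring lra.

Set Implicit Arguments.
Unset Strict Implicit.
Unset Printing Implicit Defensive.

Import Order.TTheory GRing.Theory Num.Theory.
Import numFieldNormedType.Exports.

Local Open Scope classical_set_scope.
Local Open Scope ring_scope.

Section Definitions.
Context {R : realType} {d : nat}.

Definition dotp (u v : 'rV[R]_d) : R := \sum_(i < d) u 0 i * v 0 i.

(* The library norm on ['rV[R]_d] is the sup norm, hence this separate one. *)
Definition enorm (u : 'rV[R]_d) : R := Num.sqrt (dotp u u).

Definition halfspace (w : 'rV[R]_d) (t : R) : set 'rV[R]_d :=
  [set x | t <= dotp w x].

End Definitions.

Definition sphere (R : realType) (d : nat) : set 'rV[R]_d :=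
  [set x | enorm x = 1].
Arguments sphere : clear implicits.

Definition borelRd (R : realType) (d : nat) :=
  g_sigma_algebraType (@open 'rV[R]_d).

(* The uniform probability measure on the sphere, viewed as a Borel measure on
   R^d carried by the sphere: it is the rotation-invariant one. *)
Definition uniform_on_sphere (R : realType) (d : nat)
    (sigma : probability (borelRd R d) R) : Prop :=
  sigma (sphere R d) = 1%E /\
  forall O : 'M[R]_d, O *m O^T = 1%:M ->
    forall A : set (borelRd R d), measurable A ->
      sigma [set x | A (x *m O)] = sigma A.

Section Discrepancy.
Context {R : realType} {d : nat} (sigma : probability (borelRd R d) R).

(* For sigma uniform this does not depend on w: see [mu_cap_indep]. *)
Definition mu_cap (w : 'rV[R]_d) (t : R) : R :=
  fine (sigma (sphere R d `&` halfspace w t)).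

Definition mu_emp {N : nat} (X : 'I_N -> sphere R d) (w : 'rV[R]_d) (t : R) : R :=
  N%:R^-1 * #|[pred i : 'I_N | set_val (X i) \in halfspace w t]|%:R.

(* [{ptws 'I_N -> sphere R d}] is the N-fold product of the sphere, with the
   product topology. *)
Definition discrepancy {N : nat} (X : {ptws 'I_N -> sphere R d}) : R :=
  sup [set r | exists w t, [/\ sphere R d w, -1 <= t <= 1 &
                               r = `|mu_emp X w t - mu_cap w t|]].

End Discrepancy.

Section SanityChecks.
Context {R : realType} {d : nat}.
Implicit Types u v w x y : 'rV[R]_d.

Lemma dotpE u v : dotp u v = (u *m v^T) 0 0.
Proof. by rewrite mxE; apply: eq_bigr => i _; rewrite mxE. Qed.

Lemma dotpC u v : dotp u v = dotp v u.
Proof. by apply: eq_bigr => i _; rewrite mulrC. Qed.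

Lemma dotpBl u v x : dotp (u - v) x = dotp u x - dotp v x.
Proof. by rewrite !dotpE mulmxBl !mxE. Qed.

Lemma dotp_ge0 u : 0 <= dotp u u.
Proof. by apply: sumr_ge0 => i _; rewrite -expr2 sqr_ge0. Qed.

Lemma dotp_eq0 u : dotp u u = 0 -> u = 0.
Proof.
move=> /eqP; rewrite psumr_eq0; last by move=> i _; rewrite -expr2 sqr_ge0.
move=> /allP u0; apply/rowP => i; rewrite mxE; apply/eqP.
by have := u0 i (mem_index_enum i); rewrite -expr2 sqrf_eq0.
Qed.

Lemma dotp_sphere w : sphere R d w -> dotp w w = 1.
Proof. by rewrite /sphere /enorm /= => w1; rewrite -[LHS]sqr_sqrtr ?dotp_ge0// w1 expr1n. Qed.

Lemma enorm_coord u i : `|u 0 i| <= enorm u.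
Proof.
rewrite -sqrtr_sqr ler_sqrt ?dotp_ge0//.
by rewrite /dotp (bigD1 i)//= -expr2 lerDl sumr_ge0// => j _; rewrite -expr2 sqr_ge0.
Qed.

(* The topology of ['rV[R]_d] is the one of the Euclidean metric. *)
Lemma nbhs_enorm x (A : set 'rV[R]_d) :
  nbhs x A <-> exists2 e : R, 0 < e & forall y, enorm (x - y) < e -> A y.
Proof.
split.
  move=> /nbhs_ballP[e e0 xA]; exists e => // y xy; apply: xA; split => // i j.
  rewrite ord1 /ball/=; apply: le_lt_trans xy.
  by have := enorm_coord (x - y) j; rewrite !mxE.
move=> [e e0 xA]; apply/nbhs_ballP.
have de : 0 < e / d.+1%:R by rewrite divr_gt0.
exists (e / d.+1%:R) => // y [_ xy]; apply: xA.
have h i : `|(x - y) 0 i| < e / d.+1%:R by have := xy 0 i; rewrite /ball/= !mxE.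
rewrite -[ltRHS]gtr0_norm// -sqrtr_sqr ltr_sqrt ?exprn_gt0//.
apply: (@le_lt_trans _ _ (\sum_(i < d) (e / d.+1%:R) ^+ 2)).
  apply: ler_sum => i _; rewrite -expr2 -real_normK ?num_real//.
  by rewrite lerXn2r ?nnegrE ?normr_ge0 ?ltW.
rewrite sumr_const card_ord expr_div_n -[ltLHS]mulr_natr -mulrA gtr_pMr ?exprn_gt0//.
rewrite mulrC ltr_pdivrMr ?exprn_gt0// mul1r -natrX ltr_nat.
by rewrite (leq_trans (ltnSn d))// leq_pmulr.
Qed.

Lemma dotp_continuous w : continuous (dotp w).
Proof.
apply: continuous_big => [|i _ x]; first exact: add_continuous.
exact: (cvgM (cvg_cst (w 0 i)) (@coord_continuous R 1 d 0 i x)).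
Qed.

Lemma dotp_sqr_continuous : continuous (fun x => dotp x x).
Proof.
apply: continuous_big => [|i _ x]; first exact: add_continuous.
exact: (cvgM (@coord_continuous R 1 d 0 i x) (@coord_continuous R 1 d 0 i x)).
Qed.

Lemma measurable_halfspace w t : measurable (halfspace w t : set (borelRd R d)).
Proof.
rewrite -[halfspace w t]setCK; apply: measurableC; apply: sub_sigma_algebra.
rewrite -closedC setCK.
exact: (proj1 (continuous_closedP _) (@dotp_continuous w) _ (@closed_ge R t)).
Qed.

Lemma measurable_sphere : measurable (sphere R d : set (borelRd R d)).
Proof.
rewrite -[sphere R d]setCK; apply: measurableC; apply: sub_sigma_algebra.
rewrite -closedC setCK.
have -> : sphere R d = (fun x => dotp x x) @^-1` [set 1].
  apply/seteqP; split => x /=; first exact: dotp_sphere.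
  by rewrite /sphere /enorm /= => ->; rewrite sqrtr1.
exact: (proj1 (continuous_closedP _) dotp_sqr_continuous _ (@closed_eq R 1)).
Qed.

Lemma sphere_reflection u v : sphere R d u -> sphere R d v ->
  exists2 O : 'M[R]_d, O *m O^T = 1%:M & u *m O = v.
Proof.
move=> /dotp_sphere u1 /dotp_sphere v1; have [->|uv] := eqVneq u v.
  by exists 1%:M; rewrite ?trmx1 mulmx1.
set a := u - v; set c := dotp a a.
have c0 : c != 0 by apply: contra uv => /eqP/dotp_eq0/eqP; rewrite subr_eq0.
have aaE : a *m a^T = c%:M by rewrite [LHS]mx11_scalar /c dotpE.
have uaE : u *m a^T = (c / 2)%:M.
  rewrite [LHS]mx11_scalar -dotpE; congr (_%:M).
  rewrite /c dotpC !dotpBl ![dotp _ a]dotpC !dotpBl u1 v1 (dotpC u v); lra.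
pose M : 'M[R]_d := (2 / c) *: (a^T *m a).
have MT : M^T = M by rewrite /M linearZ/= trmx_mul trmxK.
have MM : M *m M = M + M.
  rewrite /M -scalemxAl -scalemxAr -mulmxA (mulmxA a) aaE mul_scalar_mx.
  rewrite -scalemxAr !scalerA -scalerDl; congr (_ *: _); by field.
exists (1%:M - M).
  rewrite linearB/= trmx1 MT mulmxBl mul1mx mulmxBr mulmx1 MM.
  by rewrite opprB addrK addrNK.
rewrite mulmxBr mulmx1 /M -scalemxAr mulmxA uaE mul_scalar_mx scalerA.
have -> : 2 / c * (c / 2) = 1 by field.
by rewrite scale1r /a opprB addrC addrNK.
Qed.

Lemma mu_cap_indep (sigma : probability (borelRd R d) R) u v t :
  uniform_on_sphere sigma -> sphere R d u -> sphere R d v ->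
  mu_cap sigma u t = mu_cap sigma v t.
Proof.
move=> [_ inv] Su Sv; have [Q QQ uQ] := sphere_reflection Su Sv.
rewrite /mu_cap -[in RHS](inv Q QQ); last first.
  apply: measurableI; [exact: measurable_sphere|exact: measurable_halfspace].
have dQ x y : dotp (x *m Q) (y *m Q) = dotp x y.
  by rewrite !dotpE trmx_mul mulmxA -(mulmxA x) QQ mulmx1.
congr (fine (sigma _)); apply/seteqP; split => x /=;
  by rewrite /sphere/halfspace/enorm/= -uQ !dQ.
Qed.

End SanityChecks.

(* Main.v *)
(** Let [F t] be the measure of a cap of level [t]. If every point of [X]
    moves by at most [r], the points of [X] in the half-space [H(w, t)] end
    up in [H(w, t - r)] and those ending up in [H(w, t + r)] come from [H(w,
    t)], so the discrepancy changes by at most the oscillation of [F] over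
    an interval of length [2 r]. It remains to see that [F] is uniformly
    continuous, i.e. by compactness that every slice [<w, x> = t] of the
    sphere is null. Take the directions [w_k] proportional to [(k ^ (i ^
    2))_i]: for a fixed point [x] of the sphere, the [k] such that [<w_k, x>
    = t] are roots of one nonzero polynomial, hence finitely many. So the
    slices in the directions [w_k], which all have the same measure by
    rotation invariance, have an empty limit superior, and are null. *)
Require Import Defs.
From mathcomp Require Import all_boot all_order all_algebra.
From mathcomp Require Import all_classical all_reals all_analysis.
From mathcomp Require Import ring lra.
From mathcomp Require polyrcf.
Import Order.TTheory GRing.Theory Num.Theory.
Import numFieldNormedType.Exports.

Set Implicit Arguments.
Unset Strict Implicit.
Unset Printing Implicit Defensive.

Local Open Scope classical_set_scope.
Local Open Scope ring_scope.

(** * Inner product estimates on the sphere *)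

Section DotProduct.
Context {R : realType} {d : nat}.
Implicit Types u v w x y : 'rV[R]_d.

Lemma dotpZl a u v : dotp (a *: u) v = a * dotp u v.
Proof. by rewrite !dotpE -scalemxAl mxE. Qed.

Lemma sphere_normalize v : dotp v v != 0 -> sphere R d ((enorm v)^-1 *: v).
Proof.
move=> v0; rewrite /sphere/= {1}/enorm dotpZl dotpC dotpZl.
have e0 : enorm v != 0 by rewrite sqrtr_eq0 -ltNge lt_def v0 dotp_ge0.
have -> : dotp v v = enorm v ^+ 2 by rewrite sqr_sqrtr ?dotp_ge0.
by rewrite [X in Num.sqrt X](_ : _ = 1) ?sqrtr1//; field.
Qed.

Lemma sphere_dotp_le1 w x : sphere R d w -> sphere R d x -> `|dotp w x| <= 1.
Proof.
move=> /dotp_sphere w1 /dotp_sphere x1; rewrite ler_norml.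
(* Cauchy-Schwarz for unit vectors: expand the squared lengths of [w - x] and [w + x]. *)
have := dotp_ge0 (w - x); have := dotp_ge0 (w - - x).
have N u : dotp (- x) u = - dotp x u by rewrite -scaleN1r dotpZl mulN1r.
rewrite !dotpBl ![dotp _ (_ - _)]dotpC !dotpBl !(N, w1, x1) ![dotp _ (- _)]dotpC.
by rewrite !N ![dotp x _]dotpC x1 => *; apply/andP; split; lra.
Qed.

Lemma sphere_dotp_le_norm w u : sphere R d w ->
  `|dotp w u| <= \sum_(i < d) `|u 0 i|.
Proof.
move=> w1; apply: le_trans (ler_norm_sum _ _ _) _; apply: ler_sum => i _.
by rewrite normrM ler_piMl// (le_trans (enorm_coord w i))// w1.
Qed.

Lemma dotp_mulmx_orthogonal (Q : 'M[R]_d) x y : Q *m Q^T = 1%:M ->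
  dotp (x *m Q) (y *m Q) = dotp x y.
Proof. by move=> QQ; rewrite !dotpE trmx_mul mulmxA -(mulmxA x) QQ mulmx1. Qed.

End DotProduct.

(** * A curve of directions meeting each slice condition finitely often *)

Section PowerCurve.
Context {R : realType} {d : nat}.
Implicit Types (x : 'rV[R]_d) (s t : R).

(** The exponents are distinct, start with 0 and 1 and skip 2. This gap makes the squared slice
    equation in [s] nontrivial. *)
Definition curve s : 'rV[R]_d := \row_i s ^+ (i * i).

Definition dotp_curve_poly x : {poly R} := \sum_(i < d) x 0 i *: 'X^(i * i).

Definition sqr_curve_poly : {poly R} := \sum_(i < d) 'X^(i * i + i * i).

Lemma horner_dotp_curve_poly x s : (dotp_curve_poly x).[s] = dotp (curve s) x.
Proof.
rewrite horner_sum; apply: eq_bigr => i _.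
by rewrite hornerZ hornerXn mxE mulrC.
Qed.

Lemma horner_sqr_curve_poly s :
  sqr_curve_poly.[s] = dotp (curve s) (curve s).
Proof.
rewrite horner_sum; apply: eq_bigr => i _.
by rewrite hornerXn !mxE exprD.
Qed.

Lemma coef_dotp_curve_poly x (i : 'I_d) :
  (dotp_curve_poly x)`_(i * i) = x 0 i.
Proof.
rewrite coef_sum (bigD1 i)//= coefZ coefXn eqxx mulr1 big1 ?addr0// => j ji.
rewrite coefZ coefXn; case: eqP => [|_]; last by rewrite mulr0.
move=> e; case/eqP: ji; apply/val_inj/eqP => /=.
by rewrite -eqn_sqr -!mulnn e.
Qed.

Lemma coef_dotp_curve_poly0 x n : (forall i : 'I_d, n != i * i)%N ->
  (dotp_curve_poly x)`_n = 0.
Proof.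
move=> ni; rewrite coef_sum big1// => i _.
by rewrite coefZ coefXn (negbTE (ni i)) mulr0.
Qed.

Lemma coef_sqr_curve_poly (i : 'I_d) : sqr_curve_poly`_(i * i + i * i) = 1.
Proof.
rewrite coef_sum (bigD1 i)//= coefXn eqxx big1 ?addr0// => j ji.
rewrite coefXn; case: eqP => [|//].
move=> e; case/eqP: ji; apply/val_inj/eqP => /=.
by rewrite -eqn_sqr -!mulnn; apply/eqP/double_inj; rewrite -!addnn.
Qed.

Lemma coef_sqr_curve_poly0 n : (forall i : 'I_d, n != i * i + i * i)%N ->
  sqr_curve_poly`_n = 0.
Proof.
by move=> ni; rewrite coef_sum big1// => i _; rewrite coefXn (negbTE (ni i)).
Qed.

(* Comparing the coefficients of degree 0, 1 and 2 gives [x_0 ^+ 2 = t ^+ 2],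
   [x_0 * x_1 = 0] and [x_1 ^+ 2 = t ^+ 2]: no exponent [i * i] equals 2. *)
Lemma curve_poly_neq0 x t : (1 < d)%N -> sphere R d x ->
  dotp_curve_poly x ^+ 2 - t ^+ 2 *: sqr_curve_poly != 0.
Proof.
move=> d1 x1; apply/eqP => /subr0_eq pq.
pose i0 := Ordinal (ltnW d1); pose i1 := Ordinal d1.
have p0 : (dotp_curve_poly x)`_0 = x 0 i0 := coef_dotp_curve_poly x i0.
have p1 : (dotp_curve_poly x)`_1 = x 0 i1 := coef_dotp_curve_poly x i1.
have p2 : (dotp_curve_poly x)`_2 = 0.
  by apply: coef_dotp_curve_poly0 => -[[|[|i]] ?] //=;
    rewrite !mulSn !addSn !addnS.
have q0 : sqr_curve_poly`_0 = 1 := coef_sqr_curve_poly i0.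
have q1 : sqr_curve_poly`_1 = 0.
  by apply: coef_sqr_curve_poly0 => i; rewrite addnn; case: (i * i)%N.
have q2 : sqr_curve_poly`_2 = 1 := coef_sqr_curve_poly i1.
have c n := congr1 (fun r : {poly R} => r`_n) pq.
move: (c 0%N) (c 1%N) (c 2%N).
rewrite !coefZ q0 q1 q2 expr2 !coefM !big_ord_recl !big_ord0 /= ?subn0 ?subnn.
rewrite /bump /= ?subn1 ?p0 ?p1 ?p2 /= ?p0 ?p1 ?p2.
rewrite ?mulr0 ?mul0r ?mulr1 ?addr0 ?add0r => e0 e1 e2.
(* Whichever of the first two coordinates vanishes, its square equals [t ^+ 2]. *)
have t0 : t ^+ 2 = 0.
  have : (x 0 i0 * x 0 i1) = 0 by move: e1; rewrite (mulrC (x 0 i1)) => ?; lra.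
  by move/eqP; rewrite mulf_eq0 => /orP[]/eqP z;
    [rewrite -e0 z mul0r|rewrite -e2 z mul0r].
(* Now the polynomial itself is zero, and its coefficients include all coordinates of [x]. *)
move: pq; rewrite t0 scale0r => /eqP; rewrite expf_eq0/= => /eqP px.
suff x0 : x = 0.
  move/dotp_sphere: x1; rewrite x0 dotpE mul0mx mxE => /esym/eqP.
  by rewrite oner_eq0.
by apply/rowP => i; rewrite mxE -coef_dotp_curve_poly px coef0.
Qed.

Lemma curve_neq0 s : (0 < d)%N -> dotp (curve s) (curve s) != 0.
Proof.
(* The coordinate of index 0 is [s ^+ 0 = 1], even at [s = 0]. *)
move=> d0; rewrite gt_eqF// (@lt_le_trans _ _ 1)// /dotp (bigD1 (Ordinal d0))//=.
rewrite !mxE !expr0 mulr1 lerDl sumr_ge0// => i _.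
by rewrite -expr2 sqr_ge0.
Qed.

Definition curve_dir s : 'rV[R]_d := (enorm (curve s))^-1 *: curve s.

Lemma sphere_curve_dir s : (0 < d)%N -> sphere R d (curve_dir s).
Proof. by move=> d0; apply: sphere_normalize; exact: curve_neq0. Qed.

(** Clearing the normalization and squaring removes the square root, so each bad [k] is a root of
    the nonzero polynomial of [curve_poly_neq0]. Beyond its Cauchy bound there are no roots. *)
Lemma curve_dir_dotp_finite x t : (1 < d)%N -> sphere R d x ->
  exists n : nat, forall k : nat, (n <= k)%N -> dotp (curve_dir k%:R) x != t.
Proof.
move=> d1 x1; have f0 := curve_poly_neq0 t d1 x1.
set f := (X in X != 0) in f0.
exists (Num.bound (polyrcf.cauchy_bound f)) => k nk; apply/eqP => kt.
have : ~~ root f k%:R.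
  apply: polyrcf.ge_cauchy_bound => //; rewrite in_itv/= andbT.
  rewrite (le_trans (ltW (archi_boundP _)))//; last by rewrite ler_nat.
  exact: polyrcf.cauchy_bound_ge0.
apply/negP/negPn; apply/rootP.
rewrite /f hornerD hornerN hornerZ horner_exp horner_dotp_curve_poly.
rewrite horner_sqr_curve_poly -kt dotpZl.
have c0 := curve_neq0 k%:R (ltnW d1).
have e0 : enorm (curve k%:R) != 0 by rewrite sqrtr_eq0 -ltNge lt_def c0 dotp_ge0.
have -> : dotp (curve k%:R) (curve k%:R) = enorm (curve k%:R) ^+ 2.
  by rewrite sqr_sqrtr ?dotp_ge0.
by field.
Qed.

End PowerCurve.

(** * Measures of slices and caps *)

Section Caps.
Context {R : realType} {d : nat} (sigma : probability (borelRd R d) R).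
Implicit Types (w x : 'rV[R]_d) (e r s t : R).

Definition slice w (B : set R) : set (borelRd R d) :=
  sphere R d `&` [set x | B (dotp w x)].

Lemma measurable_slice w (B : set R) : closed B -> measurable (slice w B).
Proof.
move=> cB; apply: measurableI; first exact: measurable_sphere.
rewrite -[X in measurable X]setCK; apply: measurableC; apply: sub_sigma_algebra.
rewrite -closedC setCK.
exact: (proj1 (continuous_closedP _) (@dotp_continuous R d w) _ cB).
Qed.

Context (usigma : uniform_on_sphere sigma).

(** A reflection exchanging [u] and [v] carries one slice to the other and preserves [sigma]. *)
Lemma slice_indep u v (B : set R) : closed B ->
  sphere R d u -> sphere R d v -> sigma (slice u B) = sigma (slice v B).
Proof.
move=> cB Su Sv; have [Q QQ uQ] := sphere_reflection Su Sv.
rewrite -[in RHS](usigma.2 Q QQ); last exact: measurable_slice.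
congr (sigma _); apply/seteqP; split => x /=;
  by rewrite /slice/sphere/enorm/= -uQ !dotp_mulmx_orthogonal.
Qed.

(* All the slices in the directions [curve_dir k] have the same measure, while
   no point of the sphere lies in infinitely many of them. *)
Lemma slice1_null w t : (1 < d)%N -> sphere R d w -> sigma (slice w [set t]) = 0.
Proof.
move=> d1 Sw; pose A (k : nat) := slice (curve_dir k%:R) [set t].
have mA k : measurable (A k) by apply: measurable_slice; exact: closed_eq.
(* Tails of the limit superior: they decrease to the empty set, so their measures tend to 0, while
   each [D n] contains [A n]. *)
pose D n := \bigcup_(k in [set k | (n <= k)%N]) A k.
have mD n : measurable (D n) by apply: bigcup_measurable => k _.
have D0 : \bigcap_n D n = set0.
  apply/seteqP; split => // x Dx; have [k _ [Sx _]] := Dx 0%N I.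
  have [n nP] := curve_dir_dotp_finite t d1 Sx.
  by have [j /= nj [_ /= xt]] := Dx n I; have := nP _ nj; rewrite xt eqxx.
have : sigma (D n) @[n --> \oo] --> sigma (\bigcap_n D n).
  apply: nonincreasing_cvg_mu => //.
  - by rewrite (le_lt_trans (probability_le1 _ _)) ?ltry.
  - by rewrite D0.
  - move=> m n mn; apply/subsetPset => x [k /= nk Ak]; exists k => //=.
    exact: leq_trans mn nk.
rewrite D0 measure0 => cD; apply/eqP; rewrite eq_le measure_ge0 andbT.
have -> : 0%E = lim (sigma (D n) @[n --> \oo]) by apply/esym/cvg_lim.
apply: lime_ge; first by apply/cvg_ex; exists 0%E.
apply: nearW => n.
rewrite (@slice_indep _ (curve_dir n%:R) _ (@closed_eq R t))//; last first.
  exact/sphere_curve_dir/ltnW.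
apply: le_measure; rewrite ?inE//; first exact: mA.
by move=> x Ax; exists n => /=.
Qed.

(** Continuity from above: the slices over intervals shrinking to [t] decrease to a null slice. *)
Lemma slice_itv_small w t e : (1 < d)%N -> sphere R d w -> 0 < e ->
  exists2 r : R, 0 < r & (sigma (slice w `[(t - r)%R, (t + r)%R]) < e%:E)%E.
Proof.
move=> d1 Sw e0; pose A (k : nat) := slice w `[t - k.+1%:R^-1, t + k.+1%:R^-1].
have mA k : measurable (A k) by apply: measurable_slice; exact: itv_closed.
have A0 : \bigcap_n A n = slice w [set t].
  apply/seteqP; split => x => [Ax|[Sx /= xt]].
    split; first by have [] := Ax 0%N I.
    suff xt (r : R) : 0 < r -> `|dotp w x - t| <= r.
      apply/eqP; rewrite -subr_eq0 -normr_le0; apply/ler_addgt0Pl => r r0.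
      by rewrite addr0; exact: xt.
    move=> r0; have [k _ /(_ k) kr] := near_infty_natSinv_lt (PosNum r0).
    have {}kr : k.+1%:R^-1 < r by apply: kr => /=.
    have [_ /=] := Ax k I; rewrite in_itv/= => /andP[xk1 xk2].
    rewrite ler_norml; move: (dotp w x) (k.+1%:R^-1) kr xk1 xk2 => a b kr xk1 xk2.
    by apply/andP; split; lra.
  move=> k _; split => //=.
  by rewrite in_itv/= xt lerDl gerDl oppr_le0 invr_ge0 ler0n.
have : sigma (A n) @[n --> \oo] --> sigma (\bigcap_n A n).
  apply: nonincreasing_cvg_mu => //.
  - by rewrite (le_lt_trans (probability_le1 _ _)) ?ltry.
  - by rewrite A0; apply: measurable_slice; exact: closed_eq.
  - move=> m n mn; apply/subsetPset => x [Sx /=]; rewrite in_itv/= => h.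
    split => //=; rewrite in_itv/=.
    have : (n.+1%:R^-1 <= m.+1%:R^-1 :> R) by rewrite lef_pV2 ?posrE// ler_nat.
    move: (n.+1%:R^-1) (m.+1%:R^-1) (dotp w x) h => a b c /andP[h1 h2] ab.
    by apply/andP; split; lra.
rewrite A0 slice1_null// => /(_ [set y | (y < e%:E)%E]).
case.
  apply: open_nbhs_nbhs; split; first exact: open_ereal_lt_ereal.
  by rewrite /= lte_fin.
by move=> k _ /(_ k (leqnn k))/= Ak; exists k.+1%:R^-1.
Qed.

(* Uniformity in the level comes from the compactness of [[-1, 1]]. *)
Lemma slice_itv_small_unif e : (1 < d)%N -> 0 < e ->
  exists2 r : R, 0 < r & forall w t, sphere R d w -> -1 <= t <= 1 ->
    (sigma (slice w `[(t - r)%R, (t + r)%R]) < e%:E)%E.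
Proof.
(* One fixed direction suffices, by [slice_indep]. *)
move=> d1 e0; pose w0 : 'rV[R]_d := curve_dir 0.
have Sw0 : sphere R d w0 by exact/sphere_curve_dir/ltnW.
have /compact_near_coveringP cpt := @segment_compact R (-1) 1.
pose P r t := (sigma (slice w0 `[(t - r)%R, (t + r)%R]) < e%:E)%E.
have : \forall r \near 0^'+, `[(-1 : R), 1] `<=` P r.
  apply: cpt => t _; have [r r0 tr] := slice_itv_small t d1 Sw0 e0.
  near=> t' s; rewrite /P (le_lt_trans _ tr)// le_measure ?inE//.
  - by apply: measurable_slice; exact: itv_closed.
  - by apply: measurable_slice; exact: itv_closed.
  (* Half of [r] is spent on moving the centre and half on the radius, so the new interval stays
     inside the old one. *)
  have s2 : s <= r / 2.
    by near: s; apply: nbhs_right_le; rewrite divr_gt0.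
  have : `|t - t'| <= r / 2.
    by near: t'; apply: cvgr_dist_le; [exact: cvg_id|rewrite divr_gt0].
  rewrite ler_norml => /andP[t1 t2] x [Sx /=]; rewrite in_itv/= => /andP[x1 x2].
  split => //=; rewrite in_itv/=; move: (dotp w0 x) x1 x2 => a x1 x2.
  by apply/andP; split; lra.
(* Only radii strictly below [r] are known to be good. *)
move=> [r /= r0 rP]; exists (r / 2); first by rewrite divr_gt0.
move=> w t Sw t1; rewrite (slice_indep _ Sw Sw0); last exact: itv_closed.
apply: rP => /=; last by rewrite in_itv.
- by rewrite sub0r normrN gtr0_norm ?divr_gt0// ltr_pdivrMr// ltr_pMr// ltr1n.
- by rewrite divr_gt0.
Unshelve. all: by end_near. Qed.

Lemma measurable_cap w t :
  measurable (sphere R d `&` halfspace w t : set (borelRd R d)).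
Proof.
by apply: measurableI; [exact: measurable_sphere|exact: measurable_halfspace].
Qed.

Lemma mu_cap_le w s t : s <= t -> mu_cap sigma w t <= mu_cap sigma w s.
Proof.
move=> st; apply: fine_le; rewrite ?fin_num_measure//; try exact: measurable_cap.
apply: le_measure; rewrite ?inE; try exact: measurable_cap.
by move=> x [Sx xt]; split => //; exact: le_trans st xt.
Qed.

(** Levels outside [[-1, 1]] matter because the shifted levels [t - r] and [t + r] may leave that
    interval. *)
Lemma mu_cap_low w t : sphere R d w -> t <= -1 -> mu_cap sigma w t = 1.
Proof.
move=> Sw t1; rewrite /mu_cap (_ : _ `&` _ = sphere R d) ?usigma.1//.
apply/seteqP; split => [x []//|x Sx]; split => //.
have := sphere_dotp_le1 Sw Sx; rewrite ler_norml => /andP[+ _].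
exact: le_trans t1.
Qed.

Lemma mu_cap_high w t : sphere R d w -> 1 < t -> mu_cap sigma w t = 0.
Proof.
move=> Sw t1; rewrite /mu_cap (_ : _ `&` _ = set0) ?measure0//.
apply/seteqP; split => // x [Sx /=]; rewrite /halfspace/= leNgt => /negP; apply.
have := sphere_dotp_le1 Sw Sx; rewrite ler_norml => /andP[_ /le_lt_trans]; exact.
Qed.

(** The cap of level [t - r] is covered by the cap of level [t + r] and the slice over
    [[t - r, t + r]], which is small uniformly in [w] and [t]. *)
Lemma mu_cap_modulus e : (1 < d)%N -> 0 < e ->
  exists2 r : R, 0 < r & forall w t, sphere R d w -> -1 <= t <= 1 ->
    mu_cap sigma w (t - r) - mu_cap sigma w (t + r) <= e.
Proof.
move=> d1 e0; have [r r0 rP] := slice_itv_small_unif d1 e0.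
exists r => // w t Sw t1; have {rP} := ltW (rP _ _ Sw t1).
have ms : measurable (slice w `[t - r, t + r]).
  by apply: measurable_slice; exact: itv_closed.
rewrite lerBlDr -lee_fin EFinD /mu_cap !fineK ?fin_num_measure//;
  try exact: measurable_cap.
move=> se; apply: le_trans (leeD2r _ se).
apply: le_trans (measureU2 _ _ _) => //; last exact: measurable_cap.
apply: le_measure; rewrite ?inE; first exact: measurable_cap.
  by apply: measurableU => //; exact: measurable_cap.
move=> x [Sx]; rewrite /halfspace/= => xt.
have [trx|/ltW xtr] := leP (t + r) (dotp w x); [by right|left].
by split => //=; rewrite in_itv/= xt.
Qed.

End Caps.

(** * The empirical measure *)

Section Empirical.
Context {R : realType} {d N : nat}.
Implicit Types (X Y : 'I_N -> sphere R d) (w : 'rV[R]_d) (t : R).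

Lemma mu_emp_ge0 X w t : 0 <= mu_emp X w t.
Proof. by rewrite /mu_emp mulr_ge0 ?invr_ge0 ?ler0n. Qed.

Lemma mu_emp_le1 X w t : mu_emp X w t <= 1.
Proof.
(* For [N = 0] the convention that the inverse of 0 is 0 makes the value 0. *)
rewrite /mu_emp; case: N X => [X|n X]; first by rewrite invr0 mul0r.
by rewrite mulrC ler_pdivrMr// mul1r ler_nat (leq_trans (max_card _)) ?card_ord.
Qed.

Lemma mu_emp_low X w t : (0 < N)%N -> sphere R d w -> t <= -1 ->
  mu_emp X w t = 1.
Proof.
move=> N0 Sw t1; rewrite /mu_emp (@eq_card _ _ 'I_N) => [|i].
  by rewrite card_ord mulVf// pnatr_eq0 -lt0n.
rewrite !inE; apply/mem_set.
have := sphere_dotp_le1 Sw (set_valP (X i)); rewrite ler_norml => /andP[+ _].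
exact: le_trans t1.
Qed.

Lemma mu_emp_high X w t : sphere R d w -> 1 < t -> mu_emp X w t = 0.
Proof.
move=> Sw t1; rewrite /mu_emp eq_card0 ?mulr0// => i; apply/negP; rewrite !inE.
rewrite /halfspace/= leNgt => /negP; apply.
have := sphere_dotp_le1 Sw (set_valP (X i)).
by rewrite ler_norml => /andP[_ /le_lt_trans]; exact.
Qed.

Lemma mu_emp_shift X Y w t (r : R) :
  (forall i, dotp w (set_val (X i)) <= dotp w (set_val (Y i)) + r) ->
  mu_emp X w t <= mu_emp Y w (t - r).
Proof.
move=> XY; rewrite /mu_emp ler_wpM2l ?invr_ge0 ?ler0n// ler_nat.
apply/subset_leq_card/fintype.subsetP => i; rewrite !inE => Xi.
by rewrite /halfspace/= lerBlDr (le_trans Xi).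
Qed.

End Empirical.

(** * Comparing the discrepancies of two configurations *)

Section DiscrepancyBounds.
Context {R : realType} {d N : nat} (sigma : probability (borelRd R d) R).
Context (usigma : uniform_on_sphere sigma).
Context (d1 : (1 < d)%N).
Implicit Types (X Y : {ptws 'I_N -> sphere R d}) (w : 'rV[R]_d) (t : R).

(** The bound extends from [[-1, 1]] to all real levels: below, both measures are 1, and above, both
    are 0. *)
Lemma discrepancy_ub X w t : (0 < N)%N -> sphere R d w ->
  `|mu_emp X w t - mu_cap sigma w t| <= discrepancy sigma X.
Proof.
move=> N0 Sw.
have in_le s : -1 <= s <= 1 ->
    `|mu_emp X w s - mu_cap sigma w s| <= discrepancy sigma X.
  move=> s1; apply: ub_le_sup; last by exists w, s.
  exists 1 => _ [v [u [Sv u1 ->]]].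
  have cap_ge0 : 0 <= mu_cap sigma v u by exact: fine_ge0.
  have cap_le1 : mu_cap sigma v u <= 1.
    rewrite -(mu_cap_low usigma Sv (lexx (-1))); apply: mu_cap_le.
    by case/andP: u1.
  have := mu_emp_ge0 X v u; have := mu_emp_le1 X v u => *.
  by rewrite ler_norml; apply/andP; split; lra.
have [t1|t1] := leP (-1) t; last first.
  rewrite mu_emp_low ?mu_cap_low ?subrr ?normr0 ?(ltW t1)//.
  by apply: le_trans (normr_ge0 _) (in_le 0 _); rewrite ler01 lerN10.
have [t2|t2] := leP t 1; first by apply: in_le; rewrite t1 t2.
rewrite mu_emp_high ?mu_cap_high ?subrr ?normr0//.
by apply: le_trans (normr_ge0 _) (in_le 0 _); rewrite ler01 lerN10.
Qed.

Lemma discrepancy_le X (c : R) :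
  (forall w t, sphere R d w -> -1 <= t <= 1 ->
    `|mu_emp X w t - mu_cap sigma w t| <= c) ->
  discrepancy sigma X <= c.
Proof.
move=> Xc; apply: ge_sup => [|_ [w [t [Sw t1 ->]]]]; last exact: Xc.
(* A witness that the set under the supremum is nonempty. *)
have Sw := @sphere_curve_dir R d 0 (ltnW d1).
by eexists; exists (curve_dir 0), 0; split=> //; rewrite ler01 lerN10.
Qed.

(** [mu_emp X w t] lies between the values of [mu_emp Y w] at [t + r] and [t - r]. These are within
    [discrepancy sigma Y] of the cap measures at the same levels, which differ by at most [e] and
    enclose the one at [t]. *)
Lemma discrepancy_shift X Y (r e : R) : (0 < N)%N -> 0 <= r ->
  (forall w t, sphere R d w -> -1 <= t <= 1 ->
    mu_cap sigma w (t - r) - mu_cap sigma w (t + r) <= e) ->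
  (forall w i, sphere R d w ->
    `|dotp w (set_val (X i)) - dotp w (set_val (Y i))| <= r) ->
  discrepancy sigma X <= discrepancy sigma Y + e.
Proof.
move=> N0 r0 rP XY; apply: discrepancy_le => w t Sw t1.
have := rP w t Sw t1.
have := discrepancy_ub Y (t - r) N0 Sw; have := discrepancy_ub Y (t + r) N0 Sw.
have := @mu_cap_le R d sigma w t (t + r); have := @mu_cap_le R d sigma w (t - r) t.
rewrite !ler_norml lerDl gerBl => /(_ r0) c1 /(_ r0) c2 /andP[a1 a2] /andP[b1 b2] m.
have XYw i : dotp w (set_val (X i)) <= dotp w (set_val (Y i)) + r.
  by have := XY w i Sw; rewrite ler_norml => /andP[_]; rewrite lerBlDl addrC.
have YXw i : dotp w (set_val (Y i)) <= dotp w (set_val (X i)) + r.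
  have := XY w i Sw; rewrite ler_norml => /andP[+ _].
  by rewrite lerBrDl lerBlDl addrC.
have XtY := @mu_emp_shift R d N X Y w t r XYw.
have YtX := @mu_emp_shift R d N Y X w (t + r) r YXw.
rewrite addrK in YtX.
by apply/andP; split; lra.
Qed.

End DiscrepancyBounds.

(** * Continuity in the product topology *)

Lemma ptws_sphere_coord_near (R : realType) (d N : nat)
    (X : {ptws 'I_N -> sphere R d}) (e : R) : 0 < e ->
  nbhs X [set Y : {ptws 'I_N -> sphere R d} |
    forall i j, `|set_val (X i) 0 j - set_val (Y i) 0 j| <= e].
Proof.
move=> e0; apply: (filter_forall (nbhs_filter X)) => i.
apply: (filter_forall (nbhs_filter X)) => j.
(* Compose the projection to the factor [i], the inclusion of the sphere and the coordinate [j]. *)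
have cX : (fun Y : {ptws 'I_N -> sphere R d} => set_val (Y i) 0 j) @ X -->
    set_val (X i) 0 j.
  apply: (@continuous_comp _ _ _
    (fun Y : {ptws 'I_N -> sphere R d} => set_val (Y i))
    (fun x : 'rV[R]_d => x 0 j)); last exact: coord_continuous.
  apply: (@cvg_comp _ _ _ (fun Y : {ptws 'I_N -> sphere R d} => Y i) set_val
    _ (nbhs (X i))); last exact: initial_continuous.
  exact: (@proj_continuous _ (fun=> sphere R d : topologicalType) i X).
by move/(@cvgrPdist_le _ _ _ _ (nbhs_filter X)) : cX; exact.
Qed.

Theorem theorem1 (R : realType) (d N : nat) (hd : (2 <= d)%N) (hN : (1 <= N)%N)
    (sigma : probability (borelRd R d) R) (hsigma : uniform_on_sphere sigma) :
  continuous (discrepancy sigma : {ptws 'I_N -> sphere R d} -> R).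
Proof.
move=> X; apply/(@cvgrPdist_le _ _ _ _ (nbhs_filter X)) => e e0.
have [r r0 rP] := mu_cap_modulus hsigma hd e0.
(* If each of the [d] coordinates moves by at most [r / d], the inner product with any unit vector
   moves by at most [r]. *)
have rd0 : 0 < r / d%:R by rewrite divr_gt0// ltr0n ltnW.
have close := ptws_sphere_coord_near X rd0.
near=> Y.
have XY w i : sphere R d w ->
    `|dotp w (set_val (X i)) - dotp w (set_val (Y i))| <= r.
  move=> Sw; rewrite dotpC [dotp w (set_val (Y i))]dotpC -dotpBl dotpC.
  apply: le_trans (sphere_dotp_le_norm _ Sw) _.
  apply: (@le_trans _ _ (\sum_(j < d) r / d%:R)).
    by apply: ler_sum => j _; rewrite !mxE; move: i j; near: Y.
  by rewrite sumr_const card_ord -[leLHS]mulr_natr divfK// pnatr_eq0 -lt0n ltnW.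
(* The closeness of [X] and [Y] is symmetric, so [discrepancy_shift] applies in both directions. *)
rewrite ler_distl; apply/andP; split.
  rewrite lerBlDr; apply: (@discrepancy_shift _ _ _ _ hsigma hd Y X r) => //.
    exact: ltW.
  by move=> w i Sw; rewrite distrC; exact: XY.
by apply: (@discrepancy_shift _ _ _ _ hsigma hd X Y r) => //; exact: ltW.
Unshelve. all: by end_near. Qed.
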